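(* Let $G=(V,E)$ be a finite undirected weighted graph with $V=\{1,\dots,n\}$ and all degrees $d_i>0$, let $d\ge1$, let $\rho:E\to O(d)$ be given with $\rho_{ji}=\rho_{ij}^{-1}$, and assume $\lambda_2(\mathcal{L}_0)>0$. Let $z\in\mathbb{R}^{dn}$ be an eigenvector of the normalized graph Connection Laplacian $\mathcal{L}_1$ for its smallest eigenvalue $\lambda_1(\mathcal{L}_1)$, and let $x=D_1^{-1/2}z$. Let $v:V\to\mathbb{S}^{d-1}$ satisfy $v_i=x_i/\|x_i\|$ whenever $x_i\neq0$, with $v_i\in\mathbb{S}^{d-1}$ arbitrary whenever $x_i=0$. Then $$\eta(v)\le 44\,\frac{\lambda_1(\mathcal{L}_1)}{\lambda_2(\mathcal{L}_0)}.$$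
   Context: $G$ is a simple graph with symmetric weights $w_{ij}=w_{ji}$, $w_{ij}>0$ if $(i,j)\in E$ and $w_{ij}=0$ otherwise; $d_i=\sum_j w_{ij}$. $O(d)$ is the group of $d\times d$ real orthogonal matrices; $\mathbb{S}^{d-1}$ is the unit sphere in $\mathbb{R}^d$. Sums $\sum_{i,j}$ run over all ordered pairs of vertices (terms with $w_{ij}=0$ vanish). For $x\in\mathbb{R}^{dn}$, $x_i\in\mathbb{R}^d$ denotes its $i$-th $d\times1$ block. Graph Laplacian: $W_0=(w_{ij})\in\mathbb{R}^{n\times n}$, $D_0=\mathrm{diag}(d_1,\dots,d_n)$, $\mathcal{L}_0=I-D_0^{-1/2}W_0D_0^{-1/2}$, with second smallest eigenvalue $\lambda_2(\mathcal{L}_0)$. Connection Laplacian: $W_1\in\mathbb{R}^{dn\times dn}$ is the symmetric matrix whose $(i,j)$-th $d\times d$ block is $w_{ij}\rho_{ij}$, $D_1\in\mathbb{R}^{dn\times dn}$ is block diagonal with $i$-th diagonal block $d_iI_{d\times d}$, and $\mathcal{L}_1=I-D_1^{-1/2}W_1D_1^{-1/2}$. For $v:V\to\mathbb{R}^d$ not identically zero, $$\eta(v)=\frac12\,\frac{\sum_{i,j}w_{ij}\|v_i-\rho_{ij}v_j\|^2}{\sum_i d_i\|v_i\|^2}.$$ *)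

(* Defs.v *)
From mathcomp Require Import all_boot all_order all_algebra.
From mathcomp Require Import polyrcf reals.

Set Implicit Arguments.
Unset Strict Implicit.
Unset Printing Implicit Defensive.

Import Order.TTheory GRing.Theory Num.Theory.
Local Open Scope ring_scope.

Section Definitions.
Variable R : realType.

(* The real eigenvalues in nondecreasing order, repeated according to their
   algebraic multiplicity ([rootsR] is the increasing list of distinct real
   roots). A symmetric matrix of size m has exactly m of them. *)
Definition eigenvalues m (A : 'M[R]_m) : seq R :=
  flatten [seq nseq (mup a (char_poly A)) a | a <- rootsR (char_poly A)].

(* Both default to 0 when there are too few eigenvalues; in particular
   [0 < lambda2 A] forces at least two. *)
Definition lambda1 m (A : 'M[R]_m) : R := (eigenvalues A)`_0.
Definition lambda2 m (A : 'M[R]_m) : R := (eigenvalues A)`_1.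

(* The norm that MathComp-Analysis puts on matrices is the sup norm. *)
Definition enorm d (u : 'cV[R]_d) : R := Num.sqrt (\sum_k u k 0 ^+ 2).

Definition orthogonal_mx d (A : 'M[R]_d) : Prop := A^T *m A = 1%:M.

Section Graph.
Variable n : nat.

Definition simple_graph (e : rel 'I_n) : Prop := symmetric e /\ irreflexive e.

Definition edge_weights (e : rel 'I_n) (w : 'M[R]_n) : Prop :=
  [/\ forall i j, w i j = w j i,
      forall i j, e i j -> 0 < w i j
    & forall i j, ~~ e i j -> w i j = 0].

Definition degree (w : 'M[R]_n) (i : 'I_n) : R := \sum_j w i j.

Definition D0_invsqrt (w : 'M[R]_n) : 'M[R]_n :=
  diag_mx (\row_i (Num.sqrt (degree w i))^-1).

Definition graph_laplacian (w : 'M[R]_n) : 'M[R]_n :=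
  1%:M - D0_invsqrt w *m w *m D0_invsqrt w.

Variable d : nat.

(* Only the values of [rho] on edges are constrained; elsewhere they are
   always multiplied by a zero weight. *)
Definition connection (e : rel 'I_n) (rho : 'I_n -> 'I_n -> 'M[R]_d) : Prop :=
  forall i j, e i j ->
    orthogonal_mx (rho i j) /\ rho j i = invmx (rho i j).

(* R^(dn), as columns made of n blocks of size d. *)
Definition blocks (x : 'cV[R]_(\sum_(i < n) d)) (i : 'I_n) : 'cV[R]_d :=
  submxcol (p_ := fun _ : 'I_n => d) x i.

Definition W1 (w : 'M[R]_n) (rho : 'I_n -> 'I_n -> 'M[R]_d) :
    'M[R]_(\sum_(i < n) d) :=
  \mxblock_(i < n, j < n) (w i j *: rho i j).

Definition D1_invsqrt (w : 'M[R]_n) : 'M[R]_(\sum_(i < n) d) :=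
  \mxdiag_(i < n) ((Num.sqrt (degree w i))^-1)%:M.

Definition connection_laplacian (w : 'M[R]_n)
    (rho : 'I_n -> 'I_n -> 'M[R]_d) : 'M[R]_(\sum_(i < n) d) :=
  1%:M - D1_invsqrt w *m W1 w rho *m D1_invsqrt w.

Definition eta (w : 'M[R]_n) (rho : 'I_n -> 'I_n -> 'M[R]_d)
    (v : 'I_n -> 'cV[R]_d) : R :=
  2^-1 * ((\sum_i \sum_j w i j * enorm (v i - rho i j *m v j) ^+ 2)
          / (\sum_i degree w i * enorm (v i) ^+ 2)).

End Graph.
End Definitions.

Arguments D1_invsqrt {R n} d w.

(* Main.v *)
Require Import Defs.
From mathcomp Require Import all_boot all_order all_algebra.
From mathcomp Require Import reals polyrcf complex spectral sesquilinear.
From mathcomp Require Import ring lra.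

(** Write [f_i = |x_i|], let [c] be the degree-weighted mean of [f], let
    [S = sum_i d_i f_i^2] and [vol = sum_i d_i]. Since [z] is an eigenvector,
    [sum_ij w_ij |x_i - rho_ij x_j|^2 = 2 lambda1 S]. As
    [|f_i - f_j| <= |x_i - rho_ij x_j|], the spectral gap of [L0] bounds the
    variance of [f] by [lambda1 S / lambda2]. So, unless [22 lambda1 >= lambda2]
    (where the trivial bound [eta <= 2] suffices), [c^2 vol] is at least
    [21/22 S], and a pointwise comparison of [c^2 |v_i - rho_ij v_j|^2] with
    [|x_i - rho_ij x_j|^2], [(f_i - c)^2] and [(f_j - c)^2] gives the bound,
    using [lambda2 <= 2]. *)

Set Implicit Arguments.
Unset Strict Implicit.
Unset Printing Implicit Defensive.

Import Order.TTheory GRing.Theory Num.Theory.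
Local Open Scope ring_scope.

(** * Characteristic polynomials and the sorted list of eigenvalues *)

Lemma char_poly_conj (F : fieldType) m (P A : 'M[F]_m) :
  P \in unitmx -> char_poly (invmx P *m A *m P) = char_poly A.
Proof.
move=> Pu; pose C := map_mx (@polyC F).
have -> : char_poly (invmx P *m A *m P) =
          \det (C _ _ (invmx P) *m char_poly_mx A *m C _ _ P).
  rewrite /char_poly; congr (\det _).
  rewrite /char_poly_mx mulmxBr mulmxBl !map_mxM /=; congr (_ - _).
  by rewrite scalar_mxC -mulmxA -map_mxM mulVmx // map_mx1 mulmx1.
rewrite !det_mulmx mulrAC -det_mulmx -map_mxM mulVmx // map_mx1 det1.
by rewrite mul1r.
Qed.

Section Eigenvalues.
Variables (R : realType) (m : nat) (A : 'M[R]_m).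

(** Each root occurs once in [rootsR], so only its own constant block contributes; a non-root has no
    block and multiplicity 0. *)
Lemma count_mem_eigenvalues a :
  count_mem a (eigenvalues A) = mup a (char_poly A).
Proof.
have p0 : char_poly A != 0 by rewrite monic_neq0 // char_poly_monic.
rewrite /eigenvalues; set r := rootsR _.
have ru : uniq r by exact: uniq_roots.
have memr : (a \in r) = root (char_poly A) a.
  by rewrite -(roots_on_rootsR p0).
rewrite count_flatten -map_comp.
rewrite (eq_map (g := fun b => (a == b) * mup b (char_poly A))%N); last first.
  by move=> b /=; rewrite count_nseq /= eq_sym.
rewrite sumnE big_map; case: (boolP (a \in r)) => [ar|ar].
  rewrite (bigD1_seq a) //= eqxx mul1n big1 ?addn0 // => b ba.
  by rewrite eq_sym (negbTE ba).
rewrite mupNroot -?memr //; apply: big1_seq => b /= br.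
by case: eqP br ar => [<- ->|].
Qed.

Lemma sorted_eigenvalues : sorted <=%R (eigenvalues A).
Proof.
rewrite /eigenvalues; set r := rootsR _; set f := fun a => _.
have : sorted <%R r by exact: sorted_roots.
elim: r => //= a r IH pr.
rewrite -[sorted _ _]/(sorted <=%R (nseq _ a ++ flatten [seq f i | i <- r])).
have rs : sorted <=%R (flatten [seq f i | i <- r]).
  exact/IH/(path_sorted pr).
have ge : all (>= a) (flatten [seq f i | i <- r]).
  apply/allP => x /flatten_mapP[b br]; rewrite mem_nseq => /andP[_ /eqP ->].
  by apply/ltW; have /allP/(_ _ br) := order_path_min lt_trans pr.
(* Inner induction on the multiplicity of the first root: its copies are prepended one at a time. *)
elim: (mup _ _) => //= k; set s := _ ++ _ => IHs.
rewrite path_sortedE ?IHs ?andbT; last exact: le_trans.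
by rewrite all_cat ge andbT; apply/allP => x; rewrite mem_nseq => /andP[_ /eqP ->].
Qed.

(** Positivity rules out the default value 0, so index 1 really lies inside the list. *)
Lemma lambda2_eigenvalue : 0 < lambda2 A -> eigenvalue A (lambda2 A).
Proof.
rewrite /lambda2 => l2.
have sz : (1 < size (eigenvalues A))%N.
  by case: ltnP l2 => // /(nth_default 0) ->; rewrite ltxx.
rewrite eigenvalue_root_char; have := mem_nth 0 sz.
rewrite -has_pred1 has_count count_mem_eigenvalues; case: (boolP (root _ _)) => //.
by move=> /mupNroot ->.
Qed.

(** By sortedness, every entry from index 1 on is at least [lambda2 A]; lists that are too short
    would give the default 0. *)
Lemma count_lt_lambda2 : 0 < lambda2 A ->
  (count (fun a : R => a < lambda2 A)%R (eigenvalues A) <= 1)%N.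
Proof.
rewrite /lambda2; have := sorted_eigenvalues.
case: (eigenvalues A) => [|a [|b s]] //=; rewrite ?ltxx // => /andP[ab bs] b0.
rewrite add0n (_ : count _ s = 0%N) ?addn0; first by case: (_ < _).
apply/eqP; rewrite -leqn0 leqNgt -has_count; apply/negP => /hasP[c cs].
by rewrite ltNge; have /allP/(_ _ cs)/= -> := order_path_min le_trans bs.
Qed.

Lemma eigenvalues_perm (s : seq R) :
  char_poly A = \prod_(a <- s) ('X - a%:P) -> perm_eq (eigenvalues A) s.
Proof.
by move=> eA; apply/allP => a _ /=; rewrite count_mem_eigenvalues eA mu_prod_XsubC.
Qed.

End Eigenvalues.

(** * Diagonalization of symmetric matrices and the Rayleigh bound for the second eigenvalue *)

(** Over [R[i]] the matrix is Hermitian, so the complex spectral theorem applies and the diagonal is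
    real. A complex unitary [P] is enough for comparing quadratic forms. *)
Lemma sym_spectral (R : realType) m (A : 'M[R]_m) : A^T = A ->
  exists (P : 'M[R[i]]_m) (a : 'I_m -> R),
  [/\ P \is unitarymx, perm_eq (eigenvalues A) [seq a i | i <- enum 'I_m] &
      map_mx (real_complex R) A
        = invmx P *m diag_mx (\row_i (real_complex R (a i))) *m P].
Proof.
move=> Asym; set AC := map_mx _ A.
have ACherm : AC \is hermsymmx.
  apply: realsym_hermsym.
    apply/is_hermitianmxP; rewrite /AC /= expr0 scale1r.
    by rewrite map_trmx Asym [RHS]map_mx_id.
  by apply/mxOverP => i j; rewrite mxE; apply/complex_realP; exists (A i j).
have /orthomx_spectralP := hermitian_normalmx ACherm.
have /mxOverP sreal := hermitian_spectral_diag_real ACherm.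
move: (spectral_unitarymx AC) sreal.
set P := spectralmx _; set sp := spectral_diag _ => Pu sreal AE.
have spE : sp = \row_i (real_complex R (complex.Re (sp 0 i))).
  by apply/rowP => i; rewrite mxE RRe_real.
exists P, (fun i => complex.Re (sp 0 i)).
split; [exact: Pu | | by rewrite -spE].
(* The factorization of the characteristic polynomial is checked over [R[i]] and descends to [R] by
   injectivity. *)
apply/eigenvalues_perm/(map_poly_inj (real_complex R)).
rewrite map_char_poly -/AC AE char_poly_conj ?unitarymx_unit //.
rewrite char_poly_trig ?diag_mx_is_trig // big_map big_enum /= rmorph_prod /=.
apply: eq_bigr => i _.
by rewrite rmorphB /= map_polyX map_polyC /= mxE eqxx mulr1n RRe_real.
Qed.

(* Only one eigenvalue lies below [lambda2], so it must be the eigenvalue [0] of [u]. *)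
Lemma rayleigh_lambda2 (R : realType) m (A : 'M[R]_m) (u y : 'cV[R]_m) :
  A^T = A -> 0 < lambda2 A -> A *m u = 0 -> u != 0 -> u^T *m y = 0 ->
  lambda2 A * (y^T *m y) 0 0 <= (y^T *m A *m y) 0 0.
Proof.
move=> Asym l2 Au0 u0 uy0.
have [P [a [Pu pe AE]]] := sym_spectral Asym.
have PPt : (P ^t* *m P = 1%:M)%sesqui.
  by rewrite -invmx_unitary // mulVmx // unitarymx_unit.
(* Coordinates of [u] and [y] in the eigenbasis; inner products and the form of [A] become sums over
   coordinates. *)
pose U := P *m map_mx (real_complex R) u; pose Y := P *m map_mx (real_complex R) y.
have conjr k l (B : 'M[R]_(k, l)) :
    ((map_mx (real_complex R) B) ^t* = map_mx (real_complex R) B^T)%sesqui.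
  apply/matrixP => i j; rewrite !mxE; apply/CrealP/complex_realP.
  by exists (B j i).
have conjP (s : 'cV[R]_m) :
    ((P *m map_mx (real_complex R) s) ^t*
     = map_mx (real_complex R) s^T *m P ^t*)%sesqui.
  by rewrite trmx_mul map_mxM conjr.
have dotE (s t : 'cV[R]_m) : real_complex R ((s^T *m t) 0 0) =
    \sum_i ((P *m map_mx (real_complex R) s) i 0)^*%C
         * (P *m map_mx (real_complex R) t) i 0.
  transitivity (((P *m map_mx (real_complex R) s) ^t*
      *m (P *m map_mx (real_complex R) t))%sesqui 0 0); last first.
    by rewrite mxE; apply: eq_bigr => i _; rewrite !mxE.
  by rewrite conjP mulmxA -(mulmxA _ _ P) PPt mulmx1 -map_mxM [RHS]mxE.
have formE : real_complex R ((y^T *m A *m y) 0 0) =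
    \sum_i real_complex R (a i) * ((Y i 0)^*%C * Y i 0).
  transitivity ((Y ^t* *m (diag_mx (\row_i (real_complex R (a i))) *m Y))%sesqui 0 0); last first.
    rewrite mxE; apply: eq_bigr => i _; rewrite mul_diag_mx !mxE.
    by rewrite mulrCA.
  rewrite /Y conjP -invmx_unitary // !mulmxA -(mulmxA _ (invmx P)) -(mulmxA _ _ P).
  by rewrite -AE -!map_mxM [RHS]mxE.
have U0 : U != 0.
  apply: contra u0 => /eqP U0; apply/eqP/(map_mx_inj (f := real_complex R)).
  by rewrite map_mx0 -[LHS]mul1mx -PPt -mulmxA -/U U0 mulmx0.
have [k Uk] : exists k, U k 0 != 0.
  by case/matrix0Pn: U0 => k [j]; rewrite ord1; exists k.
have aU i : real_complex R (a i) * U i 0 = 0.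
  have : diag_mx (\row_i (real_complex R (a i))) *m U = 0.
    rewrite -[LHS]mul1mx -(mulmxV (unitarymx_unit Pu)) -mulmxA /U.
    rewrite (mulmxA _ P) (mulmxA (invmx P)) (mulmxA (invmx P)) -AE -map_mxM Au0.
    by rewrite map_mx0 mulmx0.
  by move=> /matrixP/(_ i 0); rewrite mul_diag_mx !mxE.
have ak : a k = 0.
  apply/(@complexI R)/eqP; have /eqP := aU k.
  by rewrite mulf_eq0 (negbTE Uk) orbF.
(* Otherwise both [a i] and [a k = 0] would lie below [lambda2 A], against the count. *)
have ai i : i != k -> lambda2 A <= a i.
  move=> ik; rewrite leNgt; apply/negP => lti.
  have := count_lt_lambda2 l2; rewrite (permP pe) count_map leqNgt => /negP[].
  rewrite -size_filter -[1%N]/(size [:: k]) -[_.+1]/(size [:: i; k]).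
  apply: uniq_leq_size; first by rewrite /= inE ik.
  move=> j; rewrite !inE => /orP[] /eqP ->; rewrite mem_filter /= mem_enum ?andbT //.
  by rewrite ak.
have Ui i : i != k -> U i 0 = 0.
  move=> ik; have /eqP := aU i; rewrite mulf_eq0 => /orP[|/eqP//].
  move=> /eqP/complexI ai0; have := lt_le_trans l2 (ai i ik).
  by rewrite ai0 ltxx.
(* Only the coordinate [k] of [U] survives, so orthogonality says that [U k 0] conjugated times
   [Y k 0] vanishes. *)
have Yk : Y k 0 = 0.
  have := dotE u y; rewrite uy0 mxE rmorph0 (bigD1 k) //= big1 ?addr0; last first.
    by move=> i ik; rewrite -/U Ui // rmorph0 mul0r.
  move/esym/eqP; rewrite mulf_eq0 conjc_eq0 => /orP[|/eqP//].
  by rewrite -/U (negbTE Uk).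
rewrite -lecR rmorphM /= dotE formE mulr_sumr.
apply: ler_sum => i _; rewrite -/Y.
have [->|ik] := eqVneq i k; first by rewrite Yk !mulr0.
apply: ler_wpM2r; last by rewrite lecR ai.
by rewrite mulrC mulcJ_ge0.
Qed.

(** * The Euclidean norm *)

Section Enorm.
Variables (R : realType) (d : nat).
Implicit Types u v : 'cV[R]_d.

Lemma enorm_ge0 u : 0 <= enorm u.
Proof. exact: sqrtr_ge0. Qed.

Lemma sqr_enorm u : enorm u ^+ 2 = (u^T *m u) 0 0.
Proof.
rewrite sqr_sqrtr; last by apply: sumr_ge0 => k _; exact: sqr_ge0.
by rewrite mxE; apply: eq_bigr => k _; rewrite mxE expr2.
Qed.

Lemma enorm0_eq0 u : enorm u = 0 -> u = 0.
Proof.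
move/eqP; rewrite sqrtr_eq0 => u0; apply/matrixP => k j; rewrite ord1 mxE.
have /eqP := le_anti (introT andP (conj u0 (sumr_ge0 _ (fun k _ => sqr_ge0 (u k 0))))).
rewrite psumr_eq0 => [/allP/(_ k (mem_index_enum _))|? _]; last exact: sqr_ge0.
by rewrite sqrf_eq0 => /eqP.
Qed.

Lemma dotmxC u v : (u^T *m v) 0 0 = (v^T *m u) 0 0.
Proof. by rewrite !mxE; apply: eq_bigr => k _; rewrite !mxE mulrC. Qed.

Lemma sqr_enormB u v :
  enorm (u - v) ^+ 2 = enorm u ^+ 2 + enorm v ^+ 2 - 2 * (u^T *m v) 0 0.
Proof.
rewrite !sqr_enorm [_^T]raddfB mulmxBl !mulmxBr.
have := dotmxC v u; rewrite !mxE => ->; ring.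
Qed.

Lemma enormN u : enorm (- u) = enorm u.
Proof. by congr Num.sqrt; apply: eq_bigr => k _; rewrite mxE sqrrN. Qed.

Lemma sqr_enormZ (a : R) u : enorm (a *: u) ^+ 2 = a ^+ 2 * enorm u ^+ 2.
Proof.
rewrite !sqr_enorm !mxE mulr_sumr; apply: eq_bigr => k _; rewrite !mxE; ring.
Qed.

Lemma enorm_orthogonal (A : 'M[R]_d) u :
  orthogonal_mx A -> enorm (A *m u) = enorm u.
Proof.
move=> Ao; apply/eqP; rewrite -(@eqrXn2 _ 2) ?enorm_ge0 //; apply/eqP.
by rewrite !sqr_enorm trmx_mul mulmxA -(mulmxA _ _ A) Ao mulmx1.
Qed.

(** Cauchy-Schwarz for unit vectors, read off from [|u - v|^2 >= 0] and [|u + v|^2 >= 0]. *)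
Lemma dotmx_unit_bounds u v : enorm u = 1 -> enorm v = 1 ->
  -1 <= (u^T *m v) 0 0 <= 1.
Proof.
move=> u1 v1; have := sqr_ge0 (enorm (u - v)); have := sqr_ge0 (enorm (u - (- v))).
rewrite !sqr_enormB enormN u1 v1 mulmxN [(- _ : 'M__) 0 0]mxE.
by move=> ? ?; apply/andP; split; lra.
Qed.

End Enorm.

(** * Dirichlet energy and spectral gap of the graph Laplacian *)

Section Graph.
Variables (R : realType) (n : nat) (w : 'M[R]_n).
Hypothesis w_sym : forall i j, w i j = w j i.
Hypothesis deg_gt0 : forall i, 0 < degree w i.

Let sd i := Num.sqrt (degree w i).

Let sd_neq0 i : sd i != 0.
Proof. by rewrite sqrtr_eq0 -ltNge. Qed.

Let sd2 i : sd i * sd i = degree w i.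
Proof. by rewrite -expr2 sqr_sqrtr // ltW. Qed.

Lemma sum_degree (p : 'I_n -> R) :
  \sum_i \sum_j w i j * p i = \sum_i degree w i * p i.
Proof. by apply: eq_bigr => i _; rewrite mulr_suml. Qed.

Lemma sum_degreeC (p : 'I_n -> R) :
  \sum_i \sum_j w i j * p j = \sum_i degree w i * p i.
Proof.
rewrite exchange_big /= -sum_degree; apply: eq_bigr => i _.
by apply: eq_bigr => j _; rewrite w_sym.
Qed.

(** Kept general in [p] and [s] to serve both Laplacians: [p] holds squared norms, [s] the inner
    products along edges. *)
Lemma sum_edge_energy (p : 'I_n -> R) (s : 'I_n -> 'I_n -> R) :
  \sum_i \sum_j w i j * (p i + p j - 2 * s i j)
  = 2 * (\sum_i degree w i * p i - \sum_i \sum_j w i j * s i j).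
Proof.
rewrite mulrBr -[2 in LHS]/(1 + 1)%:R.
have -> : 2 * (\sum_i degree w i * p i)
    = \sum_i \sum_j w i j * p i + \sum_i \sum_j w i j * p j.
  by rewrite sum_degree sum_degreeC; ring.
rewrite -big_split mulr_sumr -sumrB; apply: eq_bigr => i _ /=.
rewrite -big_split mulr_sumr -sumrB; apply: eq_bigr => j _ /=; ring.
Qed.

(** This is [D0^(1/2) g]; it cancels the normalization, so the form of the Laplacian becomes the
    Dirichlet energy of [g]. *)
Let rescale (g : 'I_n -> R) : 'cV[R]_n := \col_i (sd i * g i).

Lemma graph_laplacian_rescale g i :
  (graph_laplacian w *m rescale g) i 0
  = sd i * g i - (sd i)^-1 * \sum_j w i j * g j.
Proof.
rewrite /graph_laplacian mulmxBl mul1mx -!mulmxA mxE.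
rewrite [(- _ : 'M__) i 0]mxE [rescale g i 0]mxE; congr (_ - _).
rewrite /D0_invsqrt mul_diag_mx 2!mxE; congr (_ * _).
rewrite mxE; apply: eq_bigr => j _; rewrite mul_diag_mx !mxE -/(sd j).
by rewrite mulKf.
Qed.

Lemma graph_laplacian_form g :
  ((rescale g)^T *m graph_laplacian w *m rescale g) 0 0
  = 2^-1 * \sum_i \sum_j w i j * (g i - g j) ^+ 2.
Proof.
have -> : \sum_i \sum_j w i j * (g i - g j) ^+ 2
    = \sum_i \sum_j w i j * (g i ^+ 2 + g j ^+ 2 - 2 * (g i * g j)).
  by apply: eq_bigr => i _; apply: eq_bigr => j _; ring.
rewrite sum_edge_energy mulKf ?pnatr_eq0 // -mulmxA mxE -sumrB.
apply: eq_bigr => i _; rewrite graph_laplacian_rescale !mxE -sd2 mulrBr.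
rewrite (mulrC (sd i) (g i)) -!mulrA mulVKf // mulr_sumr.
congr (_ - _); first by ring.
by apply: eq_bigr => j _; ring.
Qed.

Lemma rescale_dot g h :
  ((rescale g)^T *m rescale h) 0 0 = \sum_i degree w i * (g i * h i).
Proof. by rewrite mxE; apply: eq_bigr => i _; rewrite !mxE -sd2; ring. Qed.

Lemma rescaleE (y : 'cV[R]_n) : y = rescale (fun i => (sd i)^-1 * y i 0).
Proof. by apply/colP => i; rewrite mxE mulVKf. Qed.

Lemma graph_laplacian_sym : (graph_laplacian w)^T = graph_laplacian w.
Proof.
rewrite /graph_laplacian linearB /= trmx1 !trmx_mul tr_diag_mx mulmxA.
by congr (_ - _ *m _ *m _); apply/matrixP => i j; rewrite mxE.
Qed.

Hypothesis w_ge0 : forall i j, 0 <= w i j.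
Hypothesis l2_gt0 : 0 < lambda2 (graph_laplacian w).

(** Evaluate the form at an eigenvector for [lambda2] and use
    [(g_i - g_j)^2 <= 2 g_i^2 + 2 g_j^2]. *)
Lemma lambda2_le2 : lambda2 (graph_laplacian w) <= 2.
Proof.
have /eigenvalueP[v vL v0] := lambda2_eigenvalue l2_gt0.
pose g i := (sd i)^-1 * v 0 i.
have vE : v^T = rescale g.
  by rewrite [LHS]rescaleE; apply/colP => i; rewrite !mxE.
have := graph_laplacian_form g; rewrite -vE trmxK vL -scalemxAl mxE vE -[v]trmxK vE.
rewrite rescale_dot => E.
have S_gt0 : 0 < \sum_i degree w i * (g i * g i).
  have [i vi] : exists i, v 0 i != 0.
    by case/matrix0Pn: v0 => j [k]; rewrite ord1; exists k.
  rewrite (bigD1 i) //= ltr_wpDr //.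
    by apply: sumr_ge0 => j _; apply: mulr_ge0; [exact: ltW | rewrite -expr2 sqr_ge0].
  apply: mulr_gt0; first exact: deg_gt0.
  by rewrite -expr2 exprn_even_gt0 //= mulf_neq0 // invr_eq0.
rewrite -(ler_pM2r S_gt0) E.
have -> : 2 * (\sum_i degree w i * (g i * g i))
    = 2^-1 * \sum_i \sum_j w i j * (g i ^+ 2 *+ 2 + g j ^+ 2 *+ 2).
  have -> : \sum_i \sum_j w i j * (g i ^+ 2 *+ 2 + g j ^+ 2 *+ 2) =
    \sum_i \sum_j w i j * (g i ^+ 2 *+ 2) + \sum_i \sum_j w i j * (g j ^+ 2 *+ 2).
    rewrite -big_split; apply: eq_bigr => i _ /=.
    by rewrite -big_split; apply: eq_bigr => j _ /=; rewrite mulrDr.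
  rewrite sum_degree sum_degreeC -big_split !mulr_sumr; apply: eq_bigr => i _ /=.
  by field.
rewrite ler_pM2l ?invr_gt0 ?ltr0n //.
apply: ler_sum => i _; apply: ler_sum => j _; apply: ler_wpM2l => //.
have := sqr_ge0 (g i + g j); nra.
Qed.

(** The vector [D0^(1/2) 1] is in the kernel of the Laplacian, and weighted mean zero is
    orthogonality to it, so the Rayleigh bound applies. *)
Lemma poincare_lambda2 (g : 'I_n -> R) : \sum_i degree w i * g i = 0 ->
  lambda2 (graph_laplacian w) * \sum_i degree w i * g i ^+ 2
  <= 2^-1 * \sum_i \sum_j w i j * (g i - g j) ^+ 2.
Proof.
move=> g0; rewrite -graph_laplacian_form.
have -> : \sum_i degree w i * g i ^+ 2 = ((rescale g)^T *m rescale g) 0 0.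
  by rewrite rescale_dot; apply: eq_bigr => i _; rewrite expr2.
(* The kernel vector is nonzero only if there is a vertex. *)
have [n0|n_gt0] := posnP n.
  rewrite [X in _ * X]mxE [leRHS]mxE !big1 ?mulr0 // => i _.
    by have := ltn_ord i; rewrite [X in (_ < X)%N]n0.
  by have := ltn_ord i; rewrite [X in (_ < X)%N]n0.
apply: (rayleigh_lambda2 (u := rescale (fun=> 1))) => //.
- exact: graph_laplacian_sym.
- apply/colP => i; rewrite graph_laplacian_rescale mxE.
  rewrite (eq_bigr (w i)) => [|j _]; last by rewrite mulr1.
  by rewrite -/(degree w i) -sd2 mulKf // mulr1 subrr.
- apply/matrix0Pn; exists (Ordinal n_gt0), 0; rewrite mxE mulr1; exact: sd_neq0.
- apply/matrixP => i j; rewrite !ord1 rescale_dot mxE -[RHS]g0.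
  by apply: eq_bigr => k _; rewrite mul1r.
Qed.

End Graph.

(** * The connection Laplacian, block by block *)

Section Connection.
Variables (R : realType) (n d : nat) (w : 'M[R]_n).
Variables (rho : 'I_n -> 'I_n -> 'M[R]_d).
Implicit Types z x : 'cV[R]_(\sum_(i < n) d).

Lemma blocks_D1_invsqrt z i :
  blocks (D1_invsqrt d w *m z) i = (Num.sqrt (degree w i))^-1 *: blocks z i.
Proof.
rewrite -[z in LHS](submxcolK (p_ := fun=> d)) mul_mxdiag_mxcol /blocks mxcolK.
by rewrite mul_scalar_mx.
Qed.

Lemma blocks_W1 x i :
  blocks (W1 w rho *m x) i = \sum_j w i j *: (rho i j *m blocks x j).
Proof.
rewrite -[x in LHS](submxcolK (p_ := fun=> d)) mul_mxblock_mxrow /blocks mxcolK.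
by apply: eq_bigr => j _; rewrite -scalemxAl.
Qed.

Hypothesis deg_gt0 : forall i, 0 < degree w i.

(** Multiplying the eigenvector equation by [D1^(1/2)] turns it into [(D1 - W1) x = a D1 x], written
    here for block [i]. *)
Lemma blocks_eigenvector z (a : R) i :
  connection_laplacian w rho *m z = a *: z ->
  let x := D1_invsqrt d w *m z in
  degree w i *: blocks x i - \sum_j w i j *: (rho i j *m blocks x j)
  = (a * degree w i) *: blocks x i.
Proof.
move=> zE x; pose s := Num.sqrt (degree w i).
have s0 : s != 0 by rewrite sqrtr_eq0 -ltNge.
have sE : degree w i = s * s by rewrite -expr2 sqr_sqrtr // ltW.
have /(congr1 (fun y => s *: y)) : blocks (connection_laplacian w rho *m z) i = blocks (a *: z) i.
  by rewrite zE.
have -> : blocks (a *: z) i = a *: blocks z i by apply/matrixP => j k; rewrite !mxE.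
rewrite /connection_laplacian mulmxBl mul1mx -!mulmxA -/x.
rewrite {1}/blocks submxcolB -/(blocks z i) -/(blocks _ i) blocks_D1_invsqrt blocks_W1.
rewrite -/s scalerBr !scalerA mulfV // scale1r.
have -> : blocks z i = s *: blocks x i.
  by rewrite blocks_D1_invsqrt scalerA mulfV // scale1r.
rewrite !scalerA -sE => ->; congr (_ *: _).
by rewrite sE; ring.
Qed.

Hypothesis w_sym : forall i j, w i j = w j i.
Hypothesis rho_orth : forall i j, w i j != 0 -> orthogonal_mx (rho i j).

Lemma connection_energy (y : 'I_n -> 'cV[R]_d) :
  \sum_i \sum_j w i j * enorm (y i - rho i j *m y j) ^+ 2
  = 2 * (\sum_i degree w i * enorm (y i) ^+ 2
         - \sum_i \sum_j w i j * ((y i)^T *m (rho i j *m y j)) 0 0).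
Proof.
rewrite -(sum_edge_energy w_sym); apply: eq_bigr => i _; apply: eq_bigr => j _.
(* Off the edges [rho i j] need not be an isometry, but the weight kills the term. *)
have [->|wij] := eqVneq (w i j) 0; first by rewrite !mul0r.
by rewrite sqr_enormB enorm_orthogonal //; exact: rho_orth.
Qed.

(** Pair the block equation with [x_i] and sum over [i]. *)
Lemma eigenvector_energy z (a : R) :
  connection_laplacian w rho *m z = a *: z ->
  let x := D1_invsqrt d w *m z in
  \sum_i \sum_j w i j * enorm (blocks x i - rho i j *m blocks x j) ^+ 2
  = 2 * (a * \sum_i degree w i * enorm (blocks x i) ^+ 2).
Proof.
move=> zE x; rewrite connection_energy mulr_sumr -sumrB; congr (2 * _).
apply: eq_bigr => i _.
have /(congr1 (fun y => ((blocks x i)^T *m y) 0 0)) := blocks_eigenvector i zE.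
rewrite -/x mulmxBr mulmx_sumr -!scalemxAr [in RHS]mxE -sqr_enorm => E.
rewrite mulrA -E [RHS]mxE [(- _ : 'M__) 0 0]mxE summxE [(_ *: _ : 'M__) 0 0]mxE -sqr_enorm.
congr (_ - _); apply: eq_bigr => j _.
by rewrite -scalemxAr [RHS]mxE.
Qed.

End Connection.

(** * Real inequalities behind the constant 44 *)

(* The pairs with [a, b >= c / 2] are controlled by [4 D], those with [a < c / 2]
   (resp. [b < c / 2]) by [16 (a - c)^2] (resp. [16 (b - c)^2]), since the left-hand
   side is at most [4 c^2]. Here [s] is the inner product of the two unit directions. *)
Lemma rounding_pointwise (R : realFieldType) (a b c s : R) :
  0 <= a -> 0 <= b -> 0 <= c -> -1 <= s <= 1 ->
  c ^+ 2 * (2 - 2 * s)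
  <= 4 * (a ^+ 2 + b ^+ 2 - 2 * (a * b * s)) + 16 * ((a - c) ^+ 2 + (b - c) ^+ 2).
Proof.
move=> a0 b0 c0 /andP[s1 s2].
have D0 : 0 <= a ^+ 2 + b ^+ 2 - 2 * (a * b * s).
  have := sqr_ge0 (a - b); have : 0 <= a * b * (1 - s) by rewrite !mulr_ge0 ?subr_ge0.
  lra.
have l4 : c ^+ 2 * (2 - 2 * s) <= 4 * c ^+ 2.
  have : 0 <= c ^+ 2 * (1 + s) by rewrite mulr_ge0 ?sqr_ge0 //; lra.
  lra.
have small t : t <= c / 2 -> 4 * c ^+ 2 <= 16 * (t - c) ^+ 2.
  move=> tc; have h : 0 <= (c / 2 - t) * (3 / 2 * c - t) by apply: mulr_ge0; lra.
  have -> : 16 * (t - c) ^+ 2 = 4 * c ^+ 2 + 16 * ((c / 2 - t) * (3 / 2 * c - t)).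
    by field.
  lra.
have sa := sqr_ge0 (a - c); have sb := sqr_ge0 (b - c).
have [/small|ca] := lerP a (c / 2); first by lra.
have [/small|cb] := lerP b (c / 2); first by lra.
(* Now [a b >= c^2 / 4], and [D = (a - b)^2 + 2 a b (1 - s)], so [4 D >= 2 c^2 (1 - s)]. *)
have h : 0 <= (a * b - c / 2 * (c / 2)) * (1 - s).
  by rewrite mulr_ge0 ?subr_ge0 // ler_pM //; lra.
have sab := sqr_ge0 (a - b); nra.
Qed.

(** Here [mu], [lam] stand for [lambda2], [lambda1], [V] for the weighted variance of the norms, and
    [Q] for the numerator of [eta]. *)
Lemma rounding_conclusion (R : realFieldType) (mu lam S V vol c Q : R) :
  0 < mu -> mu <= 2 -> 0 < S -> 0 <= lam -> 0 < vol -> S = V + c ^+ 2 * vol ->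
  mu * V <= lam * S -> Q <= 4 * vol -> c ^+ 2 * Q <= 8 * (lam * S) + 32 * V ->
  2^-1 * (Q / vol) <= 44 * (lam / mu).
Proof.
move=> mu0 mu2 S0 lam0 vol0 SE muV Q4 cQ.
suff muQ : mu * Q <= 88 * (lam * vol).
  rewrite -(ler_pM2r (mulr_gt0 mu0 vol0)).
  have -> : 2^-1 * (Q / vol) * (mu * vol) = 2^-1 * (mu * Q).
    by field; rewrite ?gt_eqF.
  have -> : 44 * (lam / mu) * (mu * vol) = 44 * (lam * vol).
    by field; rewrite ?gt_eqF.
  lra.
(* The threshold is 22 = 88 / 4: beyond it [Q <= 4 vol] already suffices. *)
have [small|big] := ltrP (22 * lam) mu; last first.
  have h1 : 0 <= mu * (4 * vol - Q) by rewrite mulr_ge0 ?subr_ge0 // ltW.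
  have h2 : 0 <= (22 * lam - mu) * vol by rewrite mulr_ge0 ?subr_ge0 // ltW.
  lra.
have VS : 22 * V <= S.
  rewrite -(ler_pM2l mu0); have : 0 <= (mu - 22 * lam) * S.
    by rewrite mulr_ge0 ?subr_ge0 // ltW.
  lra.
have c2 : 0 < c ^+ 2.
  rewrite -(pmulr_lgt0 _ vol0); lra.
(* [mu c^2 Q <= 16 lam S + 32 lam S], and [S <= 22/21 c^2 vol]; the factor [48 * 22 / 21] is below
   88. *)
rewrite -(ler_pM2l c2).
have h1 : 0 <= mu * (8 * (lam * S) + 32 * V - c ^+ 2 * Q).
  by rewrite mulr_ge0 ?subr_ge0 // ltW.
have h2 : 0 <= (2 - mu) * (lam * S) by rewrite !mulr_ge0 ?subr_ge0 // ltW.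
have h3 : 0 <= lam * (22 * (c ^+ 2 * vol) - 21 * S) by rewrite mulr_ge0 // ; lra.
have h4 : 0 <= lam * S by rewrite mulr_ge0 // ltW.
lra.
Qed.

(** * The rounding estimate in polar form *)

Section Rounding.
Variables (R : realType) (n d : nat) (w : 'M[R]_n).
Variables (rho : 'I_n -> 'I_n -> 'M[R]_d).
Hypothesis w_sym : forall i j, w i j = w j i.
Hypothesis w_ge0 : forall i j, 0 <= w i j.
Hypothesis deg_gt0 : forall i, 0 < degree w i.
Hypothesis rho_orth : forall i j, w i j != 0 -> orthogonal_mx (rho i j).
Hypothesis l2_gt0 : 0 < lambda2 (graph_laplacian w).

Lemma sum_degree_gt0 (p : 'I_n -> R) k : (forall i, 0 <= p i) -> 0 < p k ->
  0 < \sum_i degree w i * p i.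
Proof.
move=> p0 pk; rewrite (bigD1 k) //= ltr_wpDr //; last by rewrite mulr_gt0.
by apply: sumr_ge0 => i _; rewrite mulr_ge0 // ltW.
Qed.

(** Writing [x_i = f_i v_i] treats vanishing blocks uniformly: there [f_i = 0] and any unit [v_i]
    fits. *)
Lemma eta_rounding_le (a : R) (f : 'I_n -> R) (v : 'I_n -> 'cV[R]_d) k :
  (forall i, 0 <= f i) -> 0 < f k -> (forall i, enorm (v i) = 1) ->
  \sum_i \sum_j w i j * enorm (f i *: v i - rho i j *m (f j *: v j)) ^+ 2
    = 2 * (a * \sum_i degree w i * f i ^+ 2) ->
  eta w rho v <= 44 * (a / lambda2 (graph_laplacian w)).
Proof.
move=> f0 fk v1 energyE.
pose s i j := ((v i)^T *m (rho i j *m v j)) 0 0.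
have s1 i j : w i j != 0 -> -1 <= s i j <= 1.
  move=> wij; apply: dotmx_unit_bounds => //.
  by rewrite enorm_orthogonal //; exact: rho_orth.
have DE i j : w i j != 0 -> enorm (f i *: v i - rho i j *m (f j *: v j)) ^+ 2
    = f i ^+ 2 + f j ^+ 2 - 2 * (f i * f j * s i j).
  move=> wij; have nE h : enorm (f h *: v h) ^+ 2 = f h ^+ 2.
    by rewrite sqr_enormZ v1 expr1n mulr1.
  rewrite sqr_enormB enorm_orthogonal ?nE; last exact: rho_orth.
  rewrite [(f i *: _)^T]linearZ -scalemxAl -!scalemxAr [(_ *: _ : 'M__) 0 0]mxE.
  by rewrite [(_ *: _ : 'M__) 0 0]mxE -(mulrA (f i)).
have qE i j : w i j != 0 -> enorm (v i - rho i j *m v j) ^+ 2 = 2 - 2 * s i j.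
  move=> wij; rewrite sqr_enormB enorm_orthogonal ?v1; last exact: rho_orth.
  by rewrite /s; ring.
pose vol := \sum_i degree w i.
pose S := \sum_i degree w i * f i ^+ 2.
pose c := (\sum_i degree w i * f i) / vol.
pose V := \sum_i degree w i * (f i - c) ^+ 2.
pose Q := \sum_i \sum_j w i j * enorm (v i - rho i j *m v j) ^+ 2.
have vol0 : 0 < vol.
  have := @sum_degree_gt0 (fun=> 1) k (fun=> ler01) ltr01.
  by rewrite (eq_bigr (degree w)) // => i _; rewrite mulr1.
have volE t : \sum_i degree w i * t = t * vol by rewrite -mulr_suml mulrC.
have S0 : 0 < S.
  by apply: (sum_degree_gt0 (k := k)) => [i|]; rewrite ?sqr_ge0 ?exprn_gt0.
have cvol : \sum_i degree w i * f i = c * vol by rewrite divfK // gt_eqF.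
have mean0 : \sum_i degree w i * (f i - c) = 0.
  under eq_bigr do rewrite mulrBr.
  by rewrite sumrB volE cvol subrr.
have c0 : 0 <= c.
  by rewrite divr_ge0 ?(ltW vol0) // sumr_ge0 // => i _; rewrite mulr_ge0 // ltW.
have SE : S = V + c ^+ 2 * vol.
  transitivity (V + 2 * c * (\sum_i degree w i * f i) - \sum_i degree w i * c ^+ 2).
    rewrite mulr_sumr -big_split -sumrB; apply: eq_bigr => i _ /=; ring.
  by rewrite volE cvol; ring.
(* The Poincaré inequality for [f - c], followed by [(f_i - f_j)^2 <= |x_i - rho_ij x_j|^2], the gap
   being [2 f_i f_j (1 - s_ij)]. *)
have muV : lambda2 (graph_laplacian w) * V <= a * S.
  apply: (le_trans (poincare_lambda2 w_sym deg_gt0 l2_gt0 mean0)).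
  rewrite -[a * S](mulKf (_ : 2 != 0 :> R)) ?pnatr_eq0 // -energyE.
  rewrite ler_pM2l ?invr_gt0 ?ltr0n //.
  apply: ler_sum => i _; apply: ler_sum => j _.
  have [->|wij] := eqVneq (w i j) 0; first by rewrite !mul0r.
  apply: ler_wpM2l => //; rewrite DE //.
  have /andP[_ sij] := s1 _ _ wij.
  have : 0 <= f i * f j * (1 - s i j) by rewrite !mulr_ge0 ?subr_ge0.
  lra.
(* The sign of [a] follows from [0 <= lambda2 V <= a S]. *)
have a0 : 0 <= a.
  rewrite -(pmulr_lge0 _ S0); apply: le_trans muV.
  rewrite mulr_ge0 ?(ltW l2_gt0) // sumr_ge0 // => i _.
  by rewrite mulr_ge0 ?sqr_ge0 // ltW.
have Q4 : Q <= 4 * vol.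
  rewrite -volE -sum_degree; apply: ler_sum => i _; apply: ler_sum => j _.
  have [->|wij] := eqVneq (w i j) 0; first by rewrite !mul0r.
  by apply: ler_wpM2l => //; rewrite qE //; have /andP[] := s1 _ _ wij; lra.
(* Summing the pointwise bound: 8 is 4 times the 2 of the energy identity, and 32 is 16 times two
   sums equal to [V]. *)
have cQ : c ^+ 2 * Q <= 8 * (a * S) + 32 * V.
  have -> : 8 * (a * S) + 32 * V
      = 4 * \sum_i \sum_j w i j * enorm (f i *: v i - rho i j *m (f j *: v j)) ^+ 2
      + 16 * (\sum_i \sum_j w i j * (f i - c) ^+ 2
              + \sum_i \sum_j w i j * (f j - c) ^+ 2).
    by rewrite energyE sum_degree (sum_degreeC w_sym (fun i => (f i - c) ^+ 2)) /V /S; ring.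
  rewrite -big_split !mulr_sumr -big_split; apply: ler_sum => i _ /=.
  rewrite -big_split !mulr_sumr -big_split; apply: ler_sum => j _ /=.
  have [->|wij] := eqVneq (w i j) 0; first by rewrite !mul0r !mulr0 addr0 mulr0 addr0.
  rewrite qE // DE //.
  have := ler_wpM2l (w_ge0 i j) (rounding_pointwise (f0 i) (f0 j) c0 (s1 _ _ wij)).
  lra.
have etaE : eta w rho v = 2^-1 * (Q / vol).
  rewrite /eta; congr (_ * (_ / _)); apply: eq_bigr => i _.
  by rewrite v1 expr1n mulr1.
rewrite etaE; apply: rounding_conclusion S0 a0 vol0 SE muV Q4 cQ => //.
exact: lambda2_le2.
Qed.

End Rounding.

Theorem mainTheorem6 (R : realType) (n d : nat) (e : rel 'I_n) (w : 'M[R]_n)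
    (rho : 'I_n -> 'I_n -> 'M[R]_d)
    (z x : 'cV[R]_(\sum_(i < n) d)) (v : 'I_n -> 'cV[R]_d) :
  (1 <= d)%N ->
  simple_graph e ->
  edge_weights e w ->
  (forall i, 0 < degree w i) ->
  connection e rho ->
  0 < lambda2 (graph_laplacian w) ->
  z != 0 ->
  connection_laplacian w rho *m z
    = lambda1 (connection_laplacian w rho) *: z ->
  x = D1_invsqrt d w *m z ->
  (forall i, enorm (v i) = 1) ->
  (forall i, blocks x i != 0 -> v i = (enorm (blocks x i))^-1 *: blocks x i) ->
  eta w rho v
    <= 44 * (lambda1 (connection_laplacian w rho)
             / lambda2 (graph_laplacian w)).
Proof.
move=> _ _ [w_sym w_pos w0] deg_gt0 rhoP l2_gt0 z0 zE xE v1 vE.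
have w_ge0 i j : 0 <= w i j.
  by case: (boolP (e i j)) => [/w_pos/ltW|/w0 ->].
have rho_orth i j : w i j != 0 -> orthogonal_mx (rho i j).
  by case: (boolP (e i j)) => [/rhoP[]|/w0 ->]; rewrite ?eqxx.
(* Polar form of [x]; at a zero block both sides vanish whatever [v i] is. *)
have xv i : blocks x i = enorm (blocks x i) *: v i.
  have [x0|x0] := eqVneq (blocks x i) 0.
    rewrite {2}x0 /enorm big1 ?sqrtr0 ?scale0r // => j _.
    by rewrite mxE expr0n.
  rewrite vE // scalerA mulfV ?scale1r //.
  by apply: contra x0 => /eqP/enorm0_eq0 ->.
(* If all blocks of [x] vanished, so would those of [z], as the degrees are positive. *)
have [k xk] : exists k, blocks x k != 0.
  apply/existsP; apply: contraNT z0; rewrite negb_exists => /forallP x0.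
  apply/eqP/(mxcolP (p_ := fun=> d)) => i; rewrite submxcol0.
  have := x0 i; rewrite negbK xE blocks_D1_invsqrt scaler_eq0 => /orP[|/eqP//].
  by rewrite invr_eq0 sqrtr_eq0 leNgt deg_gt0.
apply: (@eta_rounding_le _ _ _ _ _ w_sym w_ge0 deg_gt0 rho_orth l2_gt0 _
  (fun i => enorm (blocks x i)) v k) => //.
- by move=> i; exact: enorm_ge0.
- rewrite lt0r enorm_ge0 andbT; apply: contra xk => /eqP/enorm0_eq0 ->.
  exact: eqxx.
- have := eigenvector_energy deg_gt0 w_sym rho_orth zE; rewrite /= -xE => <-.
  by apply: eq_bigr => i _; apply: eq_bigr => j _; rewrite -!xv.
Qed.
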